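(* Let $n_1, n_2$ be positive integers and $d_1, d_2$ be non-negative integers such that $d_1 \ne d_2$ and $n_2 d_2 \ge n_1 d_1$. Then $\rho(\mathcal{G}_{d_1,n_1,d_2,n_2}) = \rho(\mathcal{M}_{d_1,n_1,d_2,n_2})$ if and only if all of the following conditions hold: (i) $n_2 d_2 + n_1 d_1$ is even; (ii) $n_2$ divides $n_1 d_1$; (iii) $n_2 \ge d_1$; (iv) $n_2(n_2-1) \ge n_2 d_2 - n_1 d_1$.
   Context: $\mathcal{M}_{d_1,n_1,d_2,n_2}$ is the set of symmetric $n\times n$ real matrices with non-negative entries (diagonal entries may be non-zero), $n = n_1+n_2$, having $n_1$ rows of sum $d_1$ and $n_2$ rows of sum $d_2$; $\rho(\mathcal{M}_{d_1,n_1,d_2,n_2})$ is the minimum of the spectral radius $\rho(M)$ over $M$ in this (compact) set. $\mathcal{G}_{d_1,n_1,d_2,n_2}$ is the family of simple undirected graphs (not necessarily connected) on $n_1+n_2$ vertices with $n_1$ vertices of degree $d_1$ and $n_2$ vertices of degree $d_2$; $\rho(\mathcal{G}_{d_1,n_1,d_2,n_2})$ is the minimum over $G$ in this family of the spectral radius $\rho(G)$ of the adjacency matrix of $G$. If the family $\mathcal{G}_{d_1,n_1,d_2,n_2}$ is empty, the equality $\rho(\mathcal{G}_{d_1,n_1,d_2,n_2}) = \rho(\mathcal{M}_{d_1,n_1,d_2,n_2})$ is regarded as false; that is, the equality means that some $G\in\mathcal{G}_{d_1,n_1,d_2,n_2}$ has $\rho(G)=\rho(\mathcal{M}_{d_1,n_1,d_2,n_2})$.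 *)

(* Defs.v *)
From HB Require Import structures.
From mathcomp Require Import all_boot all_order all_algebra complex.
From mathcomp Require Import boolp classical_sets reals.
Set Implicit Arguments.
Unset Strict Implicit.
Unset Printing Implicit Defensive.
Import Order.TTheory GRing.Theory Num.Theory.
Local Open Scope classical_set_scope.
Local Open Scope ring_scope.

(* The supremum is over the finite set of complex eigenvalues, which is
   nonempty as soon as n > 0, so it is a maximum. *)
Definition spectral_radius (R : realType) (n : nat) (A : 'M[R]_n) : R :=
  sup [set ComplexField.Normc.normc z
      | z in [set z : R[i] | eigenvalue (map_mx (real_complex R) A) z]].

(* "n1 of the f i equal a and the n2 other ones equal b"; stated with a
   partition so that it is also meaningful when a = b. *)
Definition two_valued (T : Type) (n1 n2 : nat) (f : 'I_(n1 + n2) -> T)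
    (a b : T) : Prop :=
  exists S : {set 'I_(n1 + n2)},
    #|S| = n1 /\ forall i, f i = if i \in S then a else b.

Definition matrix_family (R : realType) (d1 n1 d2 n2 : nat) :
    set 'M[R]_(n1 + n2) :=
  [set M | [/\ M^T = M, (forall i j, 0 <= M i j) &
     two_valued (fun i => \sum_j M i j) d1%:R d2%:R]].

Definition simple_graph (V : finType) (e : rel V) : Prop :=
  symmetric e /\ irreflexive e.

Definition degree (V : finType) (e : rel V) (v : V) : nat := #|[pred w | e v w]|.

Definition adjacency (R : realType) (n : nat) (e : rel 'I_n) : 'M[R]_n :=
  \matrix_(i, j) (e i j)%:R.

Definition graph_family (d1 n1 d2 n2 : nat) (e : rel 'I_(n1 + n2)) : Prop :=
  simple_graph e /\ two_valued (degree e) d1 d2.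

Definition is_min (R : realType) (E : set R) (r : R) : Prop :=
  E r /\ lbound E r.

(* The two minima are relations rather than functions, so that an empty family
   has no minimal spectral radius at all. *)
Definition is_rho_matrix (R : realType) (d1 n1 d2 n2 : nat) (r : R) : Prop :=
  is_min [set spectral_radius M | M in @matrix_family R d1 n1 d2 n2] r.

Definition is_rho_graph (R : realType) (d1 n1 d2 n2 : nat) (r : R) : Prop :=
  is_min [set s | exists2 e : rel 'I_(n1 + n2),
    graph_family d1 d2 e & spectral_radius (adjacency R e) = s] r.

(* Main.v *)
Require Import Defs.
From mathcomp Require Import all_boot all_order all_algebra reals.
From mathcomp Require Import complex classical_sets.
From mathcomp Require Import ring lra zify.

(** Let S be the set of the n1 rows of sum d1, put c = n1 d1 / n2, and let l
    be the positive root of l^2 = (d2 - c) l + d1 c.  This l is the spectral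
    radius of the 2 x 2 matrix with rows (0, d1) and (c, d2 - c), and
    (d1, l) is an eigenvector of it.  The number l is the minimum over the
    matrix family, for the following reasons.

    Lower bound.  Let v be d1 on S and l off S.  For a symmetric M with the
    prescribed row sums, the three block masses of M depend on the mass X of
    the block S x S only, and one finds
    v M v^T = l |v|^2 + (d1 - l)^2 X  ([block_vector_form]).
    As the spectral radius bounds the Rayleigh quotient ([rayleigh_le]), it is
    at least l.  If it equals l, then X = 0 because d1 <> l, and v attains
    the maximal Rayleigh quotient, hence is an eigenvector ([rayleigh_eq]);
    reading the eigenvector equation at a row outside S shows that this row
    has mass exactly c on S ([spectral_radius_two_blocks_eq]).

    Upper bound.  Conversely, a matrix M of the family that vanishes on S x S
    and has mass c on S in each of its rows outside S admits a positive vector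
    w with w M <= l w, which bounds all its eigenvalues by l
    ([spectral_radius_two_blocks_le]).  The matrix that is constant on blocks
    is of this kind, so l is indeed attained ([optimal_matrix_le]).

    So the graph minimum equals the matrix minimum iff there is a graph of
    the family in which S is independent and each vertex outside S has exactly
    c neighbours in S.  If there is one, c is an integer, a vertex of S has its d1
    neighbours among the n2 vertices outside S, the vertices outside S induce
    a graph that is regular of degree d2 - c <= n2 - 1, and the degree sum is
    even.  Conversely these conditions let one glue a biregular bipartite
    graph to a regular circulant graph ([two_block_graph_exists]). *)

Set Implicit Arguments.
Unset Strict Implicit.
Unset Printing Implicit Defensive.
Import Order.TTheory GRing.Theory Num.Theory.

(** * Spectral radius of real matrices *)

Section SpectralRadius.
Local Open Scope ring_scope.
Local Open Scope complex_scope.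
Local Open Scope sesquilinear_scope.
Variables (R : realType) (n : nat).
Implicit Types (A M : 'M[R]_n) (v : 'rV[R]_n).
Local Notation normc := ComplexField.Normc.normc.
Local Notation eigenvalueC A := (eigenvalue (map_mx (real_complex R) A)).

Lemma normr_normc (z : R[i]) : `|z| = (normc z)%:C.
Proof. by []. Qed.

(** At an index i where |u_i| / w_i is largest, u a left eigenvector, the
    eigenvector equation gives |z| |u_i| <= (|u_i| / w_i) (w |A|)_i. *)
Lemma normc_eigenvalue_le A (w : 'I_n -> R) (lam : R) (z : R[i]) :
  (forall i, 0 < w i) -> (forall i, \sum_j w j * `|A j i| <= lam * w i) ->
  eigenvalueC A z -> normc z <= lam.
Proof.
move=> w_gt0 wA /eigenvalueP[u uA u_neq0].
have [i0 ui0] : exists i, u 0 i != 0.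
  apply/existsP; apply: contraNT u_neq0; rewrite negb_exists => /forallP u0.
  by apply/eqP/rowP => i; rewrite mxE; apply/eqP; move: (u0 i); rewrite negbK.
have [i _ max_i] := @arg_maxP _ _ _ i0 xpredT (fun i => normc (u 0 i) / w i) isT.
have normc_gt0 (x : R[i]) : x != 0 -> 0 < normc x.
  by move=> x0; rewrite -ltcR -normr_normc normr_gt0.
have r_gt0 : 0 < normc (u 0 i) / w i.
  apply: lt_le_trans (max_i i0 isT); apply: divr_gt0 => //; exact: normc_gt0.
have ui_gt0 : 0 < normc (u 0 i) by rewrite pmulr_lgt0 ?invr_gt0 in r_gt0.
rewrite -(ler_pM2r ui_gt0) -ComplexField.Normc.normcM.
have -> : z * u 0 i = \sum_j u 0 j * (A j i)%:C.
  move/rowP/(_ i): uA; rewrite !mxE => <-.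
  by apply: eq_bigr => j _; rewrite mxE.
apply: (@le_trans _ _ (\sum_j normc (u 0 j) * `|A j i|)).
  rewrite -lecR -normr_normc rmorph_sum /=; apply: le_trans (ler_norm_sum _ _ _) _.
  apply: ler_sum => j _; rewrite normrM rmorphM /= -normr_normc.
  by rewrite [X in _ * X <= _]normc_def /= expr0n addr0 sqrtr_sqr.
apply: (@le_trans _ _ (normc (u 0 i) / w i * \sum_j w j * `|A j i|)).
  rewrite mulr_sumr; apply: ler_sum => j _; rewrite mulrA ler_wpM2r //.
  by rewrite -ler_pdivrMr //; exact: max_i.
apply: le_trans (ler_wpM2l (ltW r_gt0) (wA i)) _.
by rewrite mulrCA divfK ?lt0r_neq0.
Qed.

Lemma spectral_radius_le A (w : 'I_n -> R) (lam : R) :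
  0 <= lam -> (forall i, 0 < w i) ->
  (forall i, \sum_j w j * `|A j i| <= lam * w i) -> spectral_radius A <= lam.
Proof.
move=> lam_ge0 w_gt0 wA; rewrite /spectral_radius.
set E := (X in sup X); have [-> | /set0P ne] := eqVneq E set0.
  (* For n = 0 there is no eigenvalue, and the supremum is 0 by convention. *)
  by rewrite sup0.
apply: ge_sup => // _ [z zA <-]; exact: normc_eigenvalue_le wA zA.
Qed.

(** The set of moduli is bounded: all of its elements are at most the sum of all
    |A i j|, by the previous bound with weight 1. *)
Lemma normc_le_spectral_radius A (z : R[i]) :
  eigenvalueC A z -> normc z <= spectral_radius A.
Proof.
move=> zA; apply: ub_le_sup; last by exists z.
exists (\sum_i \sum_j `|A j i|) => _ [y yA <-].
apply: (@normc_eigenvalue_le A (fun=> 1)) yA => // i.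
rewrite mulr1 [leRHS](bigD1 i) //= (eq_bigr _ (fun j _ => mul1r _)).
by rewrite lerDl; apply: sumr_ge0 => j _; apply: sumr_ge0.
Qed.

(** Unitary diagonalization of M, in coordinates w = v P^-1: the gap between the
    spectral radius and the quadratic form becomes a sum of nonnegative terms,
    which yields both the Rayleigh bound and its equality case. *)
Lemma rayleigh_diagonalization M (v : 'rV[R]_n) : M^T = M ->
  exists P : 'M[R[i]]_n, exists d w : 'rV[R[i]]_n,
  [/\ forall k, 0 <= (spectral_radius M)%:C - d 0 k,
      map_mx (real_complex R) v = w *m P,
      P *m map_mx (real_complex R) M = diag_mx d *m P &
      (spectral_radius M * (\sum_i v 0 i ^+ 2) - (v *m M *m v^T) 0 0)%:C
      = \sum_k ((spectral_radius M)%:C - d 0 k) * `|w 0 k| ^+ 2].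
Proof.
move=> Msym; set A := map_mx _ M; set u := map_mx _ v.
have Aherm : A \is hermsymmx.
  apply: realsym_hermsym.
    by apply/is_hermitianmxP; rewrite expr0 scale1r map_mx_id // map_trmx Msym.
  by apply/mxOverP => i j; rewrite mxE complex_real.
have uC : u ^ Num.conj = u.
  by apply: realmxC; apply/mxOverP => i j; rewrite mxE complex_real.
set P := spectralmx A; set d := spectral_diag A.
have Punit : P \in unitmx := spectral_unit A.
have PV : invmx P = P ^t* by apply/invmx_unitary/spectral_unitarymx.
have /orthomx_spectralP Adec := hermitian_normalmx Aherm.
have PA : P *m A = diag_mx d *m P by rewrite [in LHS]Adec !mulmxA mulmxV // mul1mx.
pose w := u *m invmx P; exists P, d, w.
have uw : u = w *m P by rewrite mulmxKV.
have wE : w ^t* = P *m u^T.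
  by rewrite /w PV trmx_mul map_mxM /= trmxCK -map_trmx uC.
have sumw (x : 'rV[R[i]]_n) :
    (w *m diag_mx x *m w ^t*) 0 0 = \sum_k x 0 k * `|w 0 k| ^+ 2.
  rewrite mxE; apply: eq_bigr => k _; rewrite mul_mx_diag !mxE normCK.
  by rewrite mulrAC mulrC.
split=> //.
  (* A diagonal entry is a real eigenvalue, so it is at most its modulus. *)
  move=> k; have dk_real : d 0 k \is Num.real.
    by have /mxOverP := hermitian_spectral_diag_real Aherm; apply.
  rewrite subr_ge0; apply: le_trans (real_ler_norm dk_real) _.
  rewrite normr_normc lecR; apply: normc_le_spectral_radius.
  apply/eigenvalueP; exists (delta_mx 0 k *m P).
    by rewrite -mulmxA PA mulmxA -[_ *m diag_mx d]rowE row_diag_mx scalemxAl.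
  apply/eqP => /(congr1 (mulmx^~ (invmx P))); rewrite mulmxK // mul0mx.
  by move=> /matrixP/(_ 0 k)/eqP; rewrite !mxE !eqxx oner_eq0.
rewrite [RHS](_ : _ = (spectral_radius M)%:C * (\sum_k 1 * `|w 0 k| ^+ 2) -
   \sum_k d 0 k * `|w 0 k| ^+ 2); last first.
  rewrite mulr_sumr -sumrB; apply: eq_bigr => k _.
  by rewrite mulrBl mul1r.
have <- := sumw d.
rewrite rmorphB rmorphM /=; congr (_ * _ - _).
  transitivity ((u *m u^T) 0 0).
    rewrite mxE rmorph_sum; apply: eq_bigr => i _.
    by rewrite !mxE -rmorphM.
  have := sumw (const_mx 1); rewrite diag_const_mx mulmx1 wE mulmxA -uw => ->.
  by apply: eq_bigr => k _; rewrite mxE.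
rewrite wE mulmxA -[w *m _ *m P]mulmxA -PA mulmxA -uw.
by rewrite map_trmx -!map_mxM [RHS]mxE.
Qed.

Lemma rayleigh_le M v : M^T = M ->
  (v *m M *m v^T) 0 0 <= spectral_radius M * \sum_i v 0 i ^+ 2.
Proof.
move=> /(rayleigh_diagonalization v)[P [d [w [d_le _ _ eq_sum]]]].
rewrite -subr_ge0 -lecR rmorph0 eq_sum; apply: sumr_ge0 => k _.
by rewrite mulr_ge0 // exprn_ge0.
Qed.

(** All the terms of the diagonal sum vanish, so w only charges the eigenspace of
    the spectral radius. *)
Lemma rayleigh_eq M v : M^T = M ->
  (v *m M *m v^T) 0 0 = spectral_radius M * \sum_i v 0 i ^+ 2 ->
  v *m M = spectral_radius M *: v.
Proof.
move=> /(rayleigh_diagonalization v)[P [d [w [d_le vE PM eq_sum]]]] eq_v.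
move: eq_sum; rewrite eq_v subrr rmorph0 => /esym/eqP.
rewrite psumr_eq0 => [/allP w0|k _]; last by rewrite mulr_ge0 // exprn_ge0.
have wd : w *m diag_mx d = (spectral_radius M)%:C *: w.
  apply/rowP => k; rewrite mul_mx_diag !mxE.
  have := w0 k (mem_index_enum k); rewrite mulf_eq0 subr_eq0 expf_eq0 normr_eq0 /=.
  by case/orP => /eqP ->; rewrite ?mul0r ?mulr0 // mulrC.
apply: (@map_mx_inj R R[i] (real_complex R : {rmorphism _ -> _})); rewrite /=.
by rewrite map_mxM map_mxZ vE -mulmxA PM mulmxA wd scalemxAl.
Qed.

End SpectralRadius.

(** * Symmetric matrices with two row sums *)

Section TwoBlocks.
Local Open Scope ring_scope.
Variable R : realType.

Lemma pos_root_monic_quadratic (p q : R) :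
  0 <= p -> 0 <= q -> 0 < p + q -> exists2 l : R, 0 < l & l ^+ 2 = p * l + q.
Proof.
move=> p_ge0 q_ge0 pq_gt0; set s := Num.sqrt (p ^+ 2 + 4 * q).
have s_sqr : s ^+ 2 = p ^+ 2 + 4 * q by rewrite sqr_sqrtr //; nra.
have s_ge0 : 0 <= s by exact: sqrtr_ge0.
exists ((p + s) / 2); last by field: s_sqr.
rewrite divr_gt0 // ltNge; apply/negP => ps_le0.
have p0 : p = 0 by lra.
have s0 : s = 0 by lra.
move: s_sqr pq_gt0; rewrite s0 p0; lra.
Qed.

Variables (n : nat) (S : {set 'I_n}) (M : 'M[R]_n) (a b c l : R).
Hypotheses (l_gt0 : 0 < l) (l_root : l ^+ 2 = (b - c) * l + a * c).
Hypothesis (M_ge0 : forall i j, 0 <= M i j).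

(** The weight (a, l) is the Perron vector of the 2 x 2 quotient.  It is not
    positive when a = 0, but then c = 0 as well and (1, l) is a weight with
    w M <= l w. *)
Lemma spectral_radius_two_blocks_le :
    0 <= a -> (a = 0 -> c = 0) ->
    (forall i j, i \in S -> j \in S -> M j i = 0) ->
    (forall i, i \in S -> \sum_(j | j \notin S) M j i = a) ->
    (forall i, i \notin S -> \sum_(j in S) M j i = c) ->
    (forall i, i \notin S -> \sum_(j | j \notin S) M j i = b - c) ->
  spectral_radius M <= l.
Proof.
move=> a_ge0 ac0 M0 Ma Mc Mb.
pose a' := if a == 0 then 1 else a.
have a'_gt0 : 0 < a' by rewrite /a'; case: ifP => // a0; rewrite lt0r a0.
have le_aa' : a <= a' by rewrite /a'; case: eqP => // ->.
have a'c : a' * c = a * c.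
  by rewrite /a'; case: eqP => // a0; rewrite ac0 ?mulr0.
apply: (@spectral_radius_le _ _ _ (fun i => if i \in S then a' else l)).
- exact: ltW.
- by move=> i; case: ifP.
move=> i; rewrite (bigID (mem S)) /=.
have -> : \sum_(j in S) (if j \in S then a' else l) * `|M j i|
          = a' * \sum_(j in S) M j i.
  by rewrite mulr_sumr; apply: eq_bigr => j ->; rewrite ger0_norm.
have -> : \sum_(j | j \notin S) (if j \in S then a' else l) * `|M j i|
          = l * \sum_(j | j \notin S) M j i.
  by rewrite mulr_sumr; apply: eq_bigr => j /negbTE ->; rewrite ger0_norm.
case: ifPn => iS; last by rewrite Mc // Mb // a'c -expr2 l_root; lra.
by rewrite Ma // big1 => [|j jS]; [rewrite mulr0 add0r ler_pM2l | exact: M0].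
Qed.

Hypotheses (M_sym : M^T = M).
Hypothesis M_rowS : forall i, i \in S -> \sum_j M i j = a.
Hypothesis M_rowC : forall i, i \notin S -> \sum_j M i j = b.
Hypothesis ac_balanced : #|S|%:R * a = #|~: S|%:R * c.

Definition block_vector : 'rV[R]_n := \row_j (if j \in S then a else l).

(** With X, Y, Z the masses of the blocks S x S, S x S^c and S^c x S^c, the row
    sums give X + Y = #|S| a and Y + Z = #|S^c| b, so the form
    a^2 X + 2 a l Y + l^2 Z is affine in X; its slope is (a - l)^2. *)
Lemma block_vector_form :
  (block_vector *m M *m block_vector^T) 0 0 =
    l * (\sum_i block_vector 0 i ^+ 2) +
    (a - l) ^+ 2 * \sum_(i in S) \sum_(j in S) M i j.
Proof.
set X := \sum_(i in S) _.
pose Y := \sum_(i in S) \sum_(j | j \notin S) M i j.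
pose Z := \sum_(i | i \notin S) \sum_(j | j \notin S) M i j.
have YE : \sum_(i | i \notin S) \sum_(j in S) M i j = Y.
  rewrite exchange_big; apply: eq_bigr => i _; apply: eq_bigr => j _.
  by rewrite -[in LHS]M_sym mxE.
have cardC (x : R) : \sum_(i | i \notin S) x = #|~: S|%:R * x.
  by rewrite -sumr_const mulr_suml; apply: eq_big => [i|i _]; rewrite ?inE ?mul1r.
have XY : X + Y = #|S|%:R * a.
  rewrite -big_split /= -sumr_const mulr_suml; apply: eq_bigr => i iS.
  by rewrite mul1r -(M_rowS iS) [RHS](bigID (mem S)).
have YZ : Y + Z = #|~: S|%:R * b.
  rewrite -YE -big_split /= -cardC; apply: eq_bigr => i iS.
  by rewrite -(M_rowC iS) [RHS](bigID (mem S)).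
have norm2 : \sum_i block_vector 0 i ^+ 2 = #|S|%:R * a ^+ 2 + #|~: S|%:R * l ^+ 2.
  rewrite (bigID (mem S)) /= -cardC -sumr_const mulr_suml.
  congr (_ + _); apply: eq_bigr => i iS; first by rewrite mxE iS mul1r.
  by rewrite mxE (negbTE iS).
have -> : (block_vector *m M *m block_vector^T) 0 0 =
          a ^+ 2 * X + 2 * a * l * Y + l ^+ 2 * Z.
  rewrite -mulmxA mxE (bigID (mem S)) /=.
  have Mv i : (M *m block_vector^T) i 0 =
      a * (\sum_(j in S) M i j) + l * \sum_(j | j \notin S) M i j.
    rewrite mxE (bigID (mem S)) /= !mulr_sumr.
    congr (_ + _); apply: eq_bigr => j jS; first by rewrite !mxE jS mulrC.
    by rewrite !mxE (negbTE jS) mulrC.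
  rewrite (eq_bigr (fun i => a * (a * (\sum_(j in S) M i j) +
      l * \sum_(j | j \notin S) M i j))); last first.
    by move=> i iS; rewrite Mv mxE iS.
  rewrite [X in _ + X](eq_bigr (fun i => l * (a * (\sum_(j in S) M i j) +
      l * \sum_(j | j \notin S) M i j))); last first.
    by move=> i iS; rewrite Mv mxE (negbTE iS).
  rewrite -!mulr_sumr !big_split /= -!mulr_sumr YE -/X -/Y -/Z.
  by ring.
rewrite norm2.
have -> : Z = #|~: S|%:R * b - #|S|%:R * a + X by rewrite -YZ -XY; ring.
have -> : Y = #|S|%:R * a - X by rewrite -XY; ring.
have lN1 : l ^+ 2 * (#|S|%:R * a) = l ^+ 2 * (#|~: S|%:R * c) by rewrite ac_balanced.
have lN : l * #|~: S|%:R * l ^+ 2 = l * #|~: S|%:R * ((b - c) * l + a * c).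
  by rewrite l_root.
have aN : a * l * (#|S|%:R * a) = a * l * (#|~: S|%:R * c) by rewrite ac_balanced.
lra.
Qed.

Hypothesis S_proper : exists i, i \notin S.

Lemma block_vector_norm2_gt0 : 0 < \sum_i block_vector 0 i ^+ 2.
Proof.
have [i iS] := S_proper; rewrite (bigD1 i) //= ltr_pwDl //.
  by rewrite mxE (negbTE iS) exprn_gt0.
by apply: sumr_ge0 => j _; rewrite sqr_ge0.
Qed.

Lemma inner_mass_ge0 : 0 <= \sum_(i in S) \sum_(j in S) M i j.
Proof. by apply: sumr_ge0 => i _; apply: sumr_ge0. Qed.

Lemma spectral_radius_two_blocks_ge : l <= spectral_radius M.
Proof.
rewrite -(ler_pM2r block_vector_norm2_gt0).
apply: le_trans (rayleigh_le block_vector M_sym).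
by rewrite block_vector_form lerDl mulr_ge0 ?sqr_ge0 ?inner_mass_ge0.
Qed.

(** Equality in both inequalities behind the lower bound: the mass of S x S is
    zero as a != l, and the block vector is an eigenvector, whose equation at a
    row i outside S reads a x + l (b - x) = l^2 for the mass x of row i on S.
    The equation for l makes this (a - l) (x - c) = 0. *)
Lemma spectral_radius_two_blocks_eq : spectral_radius M <= l -> a != l ->
  (forall i j, i \in S -> j \in S -> M i j = 0) /\
  (forall i, i \notin S -> \sum_(j in S) M i j = c).
Proof.
move=> rho_le a_neq_l.
have rhoE : spectral_radius M = l.
  by apply/eqP; rewrite eq_le rho_le spectral_radius_two_blocks_ge.
have X0 : \sum_(i in S) \sum_(j in S) M i j = 0.
  have := rayleigh_le block_vector M_sym; rewrite rhoE block_vector_form.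
  rewrite gerDl pmulr_rle0; last by rewrite exprn_even_gt0 //= subr_eq0.
  by move=> X_le0; apply/eqP; rewrite eq_le X_le0 inner_mass_ge0.
have Mv : block_vector *m M = l *: block_vector.
  rewrite -rhoE; apply: rayleigh_eq => //.
  by rewrite rhoE block_vector_form X0 mulr0 addr0.
split=> [i j iS jS | i iS].
  have := psumr_eq0P (fun i _ => sumr_ge0 _ (fun j _ => M_ge0 i j)) X0 iS.
  by move=> /= Xi0; apply: (psumr_eq0P (fun j _ => M_ge0 i j) Xi0).
have := M_rowC iS; rewrite (bigID (mem S)) /= => sumb.
have : \sum_j block_vector 0 j * M i j = l ^+ 2.
  move/rowP/(_ i): Mv; rewrite !mxE (negbTE iS) -expr2 => <-.
  by apply: eq_bigr => j _; congr (_ * _); rewrite -[in LHS]M_sym mxE.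
rewrite (bigID (mem S)) /=.
rewrite (eq_bigr (fun j => a * M i j)) => [|j jS]; last by rewrite mxE jS.
rewrite [X in _ + X](eq_bigr (fun j => l * M i j)); last first.
  by move=> j jS; rewrite mxE (negbTE jS).
rewrite -!mulr_sumr => suml; move: sumb suml.
set x := \sum_(j in S) _; set y := \sum_(j | _) _ => sumb suml.
have: (a - l) * (x - c) = 0 by move: l_root; rewrite -suml -sumb; lra.
by move/eqP; rewrite mulf_eq0 !subr_eq0 (negbTE a_neq_l) => /eqP.
Qed.

End TwoBlocks.

(** * Biregular and regular graphs *)

Section Graphs.
Implicit Types n m k : nat.

Lemma degree_sum (V : finType) (e : rel V) v : degree e v = \sum_w e v w.
Proof.
rewrite /degree -sum1_card big_mkcond; apply: eq_bigr => w _.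
by rewrite inE; case: (e v w).
Qed.

Lemma handshake_even n (e : rel 'I_n) : simple_graph e -> ~~ odd (\sum_i \sum_j e i j).
Proof.
case=> e_sym e_irr.
(* Each edge is counted once from its smaller end and once from its larger. *)
have -> : \sum_i \sum_j e i j = (\sum_(i < n) \sum_(j < n) (i < j) * e i j).*2.
  rewrite -addnn [in X in _ = _ + X]exchange_big -big_split; apply: eq_bigr => i _ /=.
  rewrite -big_split; apply: eq_bigr => j _ /=; rewrite (e_sym j i).
  have [||/ord_inj ->] := ltngtP i j; rewrite ?e_irr; lia.
by rewrite odd_double.
Qed.

Lemma sum_nat_pred1 n (P : pred nat) k : k < n -> (forall j, j < n -> P j = (j == k)) ->
  \sum_(j < n) P j = 1.
Proof.
move=> k_lt PE; rewrite (bigD1 (Ordinal k_lt)) //= PE // eqxx big1 // => j.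
by rewrite -val_eqE /= PE // => /negbTE ->.
Qed.

(** Give each of the n1 left vertices d consecutive integers out of 0 .. n1 d - 1
    and join it to their residues modulo n2.  The residues of one vertex are
    distinct since d <= n2, and each residue occurs equally often since n2
    divides n1 d. *)
Lemma biregular_exists n1 n2 d : d <= n2 -> 0 < n2 -> n2 %| n1 * d ->
  exists B : 'I_n1 -> 'I_n2 -> bool,
    (forall i, \sum_j B i j = d) /\ (forall j, \sum_i B i j = n1 * d %/ n2).
Proof.
move=> d_le n2_gt0 n2_dvd.
pose stub (i : 'I_n1) (j : 'I_n2) t := (i * d + t) %% n2 == j.
pose B i j := [exists t : 'I_d, stub i j t].
have BE i j : B i j = \sum_(t < d) stub i j t :> nat.
  rewrite /B; have [/existsP[t st]|/existsPn st] :=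
      boolP [exists t : 'I_d, stub i j t]; last first.
    by rewrite big1 // => t _; rewrite (negbTE (st t)).
  rewrite (@sum_nat_pred1 _ (stub i j) t) // => s s_lt.
  rewrite /stub -(eqP st) eqn_modDl !modn_small //; have := ltn_ord t; lia.
exists B; split=> [i|j]; rewrite (eq_bigr _ (fun _ _ => BE _ _)).
  rewrite exchange_big /= -[RHS]card_ord -sum1_card; apply: eq_bigr => t _.
  apply: (@sum_nat_pred1 n2 (fun j => (i * d + t) %% n2 == j) _ (ltn_pmod _ n2_gt0)).
  by move=> j _; rewrite eq_sym.
pose F s := (s %% n2 == j : nat).
have -> : \sum_(i < n1) \sum_(t < d) stub i j t = \sum_(0 <= s < n1 * d) F s.
  rewrite big_nat_mul big_mkord; apply: eq_bigr => i _.
  rewrite -{1}[i * d]add0n mulSn big_addn addnK big_mkord.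
  by apply: eq_bigr => t _; rewrite /stub /F addnC.
rewrite -{1}(divnK n2_dvd) big_nat_mul big_mkord -[RHS]card_ord -sum1_card.
apply: eq_bigr => q _; rewrite -{1}[q * n2]add0n mulSn big_addn addnK big_mkord.
apply: (@sum_nat_pred1 n2 (fun t => (t + q * n2) %% n2 == j) j) => // t t_lt.
by rewrite addnC modnMDl modn_small.
Qed.

Lemma sum_interval m p q : \sum_(j < m) (p <= j < q) = minn m q - minn m p.
Proof. by elim: m => [|m IH]; rewrite ?big_ord0 ?min0n // big_ord_recr /= IH; lia. Qed.

(** Circulant graph on Z/m whose connection set T consists of the floor of k/2
    nonzero residues nearest to 0 on each side, together with m/2 when k is odd
    (m is then even); T is symmetric, has k elements and avoids 0. *)
Lemma regular_exists m k : k < m -> ~~ odd (m * k) ->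
  exists C : rel 'I_m, simple_graph C /\ forall i, degree C i = k.
Proof.
case: m => // m k_lt mk_even.
pose T t := [|| 1 <= t < (k./2).+1, m.+1 - k./2 <= t < m.+1 |
             odd k && (m.+1./2 <= t < (m.+1./2).+1)].
pose C (i j : 'I_m.+1) := T (j - i)%R.
have Topp (t : 'I_m.+1) : T (- t)%R = T t.
  have -> : ((- t)%R : nat) = (if t == 0 :> nat then 0 else m.+1 - t)%N.
    rewrite /=; case: eqP => [->|t0]; first by rewrite subn0 modnn.
    by rewrite modn_small //; have := ltn_ord t; lia.
  have := ltn_ord t; rewrite oddM /= in mk_even; rewrite /T.
  by case: (odd k) mk_even => /=; rewrite ?andbF ?andbT; case: eqP => /=; lia.
exists C; split; first split.
- by move=> i j; rewrite /C -GRing.opprB Topp.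
- move=> i; rewrite /C GRing.subrr /T /=; lia.
move=> i; rewrite degree_sum (reindex_inj (GRing.addrI i)) /=.
rewrite (eq_bigr (fun j : 'I_m.+1 => T j : nat)); last first.
  by move=> j _; rewrite /C GRing.addrC GRing.addKr.
rewrite (eq_bigr (fun t : 'I_m.+1 => (1 <= t < (k./2).+1) +
   ((m.+1 - k./2 <= t < m.+1) + odd k * (m.+1./2 <= t < (m.+1./2).+1)))); last first.
  move=> t _; have := ltn_ord t; rewrite oddM /= in mk_even; rewrite /T.
  by case: (odd k) mk_even => /=; rewrite ?mul0n ?mul1n; lia.
rewrite !big_split /= -big_distrr /= !sum_interval.
rewrite oddM /= in mk_even; have := odd_double_half k.
by case: (odd k) mk_even => /=; lia.
Qed.

Lemma two_block_graph_exists n1 n2 d k : d <= n2 -> 0 < n2 -> n2 %| n1 * d ->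
  k < n2 -> ~~ odd (n2 * k) ->
  exists e : rel 'I_(n1 + n2), [/\ simple_graph e,
    (forall i i', e (lshift n2 i) (lshift n2 i') = false),
    (forall i, \sum_j e (lshift n2 i) (rshift n1 j) = d),
    (forall j, \sum_i e (rshift n1 j) (lshift n2 i) = n1 * d %/ n2) &
    (forall j, \sum_j' e (rshift n1 j) (rshift n1 j') = k)].
Proof.
move=> d_le n2_gt0 n2_dvd k_lt k_even.
have [B [Bd Bc]] := biregular_exists d_le n2_gt0 n2_dvd.
have [C [[C_sym C_irr] Ck]] := regular_exists k_lt k_even.
pose e (x y : 'I_(n1 + n2)) := match split x, split y with
  | inl _, inl _ => false | inl i, inr j | inr j, inl i => B i j
  | inr j, inr j' => C j j' end.
have sl i : split (lshift n2 i : 'I_(n1 + n2)) = inl i by exact: (unsplitK (inl i)).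
have sr j : split (rshift n1 j : 'I_(n1 + n2)) = inr j by exact: (unsplitK (inr j)).
exists e; split.
- split=> [x y|x]; rewrite /e; last by case: (split x).
  by case: (split x) (split y) => [?|?] [?|?].
- by move=> i i'; rewrite /e !sl.
- by move=> i; rewrite -[RHS](Bd i); apply: eq_bigr => j _; rewrite /e sl sr.
- by move=> j; rewrite -[RHS](Bc j); apply: eq_bigr => i _; rewrite /e sl sr.
- by move=> j; rewrite -[RHS](Ck j) degree_sum; apply: eq_bigr => i _; rewrite /e !sr.
Qed.

End Graphs.

(** * The two families and their common minimum *)

Section Families.
Local Open Scope ring_scope.
Variables (R : realType) (n1 n2 : nat).
Implicit Types (e : rel 'I_(n1 + n2)) (S : {set 'I_(n1 + n2)}).

Lemma card_setC_add S : #|S| = n1 -> #|~: S| = n2.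
Proof. by move=> S1; apply/eqP; rewrite -(eqn_add2l n1) -{1}S1 cardsC card_ord. Qed.

Lemma sum_adjacency e (P : pred 'I_(n1 + n2)) i :
  \sum_(j | P j) adjacency R e i j = (\sum_(j | P j) e i j)%:R.
Proof. by rewrite natr_sum; apply: eq_bigr => j _; rewrite mxE. Qed.

Lemma tr_adjacency e : symmetric e -> (adjacency R e)^T = adjacency R e.
Proof. by move=> e_sym; apply/matrixP => i j; rewrite !mxE e_sym. Qed.

Lemma adjacency_ge0 e i j : 0 <= adjacency R e i j.
Proof. by rewrite mxE ler0n. Qed.

Lemma adjacency_matrix_family (d1 d2 : nat) e :
  graph_family d1 d2 e -> matrix_family d1 d2 (adjacency R e).
Proof.
case=> [[e_sym _] [S [S1 deg_e]]]; split; first exact: tr_adjacency.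
  exact: adjacency_ge0.
exists S; split=> // i; rewrite sum_adjacency -degree_sum deg_e.
by case: ifP.
Qed.

Definition left_block : {set 'I_(n1 + n2)} := [set lshift n2 i | i in 'I_n1].

Lemma lshift_left_block i : lshift n2 i \in left_block.
Proof. exact: imset_f. Qed.

Lemma rshift_left_block j : rshift n1 j \notin left_block.
Proof. by apply/imsetP => -[i _ /eqP]; rewrite eq_rlshift. Qed.

Lemma card_left_block : #|left_block| = n1.
Proof. by rewrite card_imset ?card_ord //; exact: lshift_inj. Qed.

Lemma sum_left_block (F : 'I_(n1 + n2) -> nat) :
  (\sum_(j in left_block) F j = \sum_i F (lshift n2 i))%N.
Proof.
rewrite big_split_ord /= [X in (_ + X)%N]big_pred0 => [|j]; last first.
  exact: negbTE (rshift_left_block j).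
by rewrite addn0; apply: eq_bigl => i; rewrite lshift_left_block.
Qed.

Lemma sum_right_block (F : 'I_(n1 + n2) -> nat) :
  (\sum_(j | j \notin left_block) F j = \sum_j F (rshift n1 j))%N.
Proof.
rewrite big_split_ord /= [X in (X + _)%N]big_pred0 => [|i]; last first.
  by rewrite lshift_left_block.
by rewrite add0n; apply: eq_bigl => j; rewrite rshift_left_block.
Qed.

Variables (d1 d2 : nat).
Hypotheses (n1_gt0 : (0 < n1)%N) (n2_gt0 : (0 < n2)%N) (d12 : d1 <> d2).
Hypothesis le_mass : (n1 * d1 <= n2 * d2)%N.
Let a : R := d1%:R.
Let b : R := d2%:R.
Let c : R := (n1 * d1)%:R / n2%:R.

Let n2_neq0 : n2%:R != 0 :> R.
Proof. by rewrite pnatr_eq0 -lt0n. Qed.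

Lemma bc_ge0 : 0 <= b - c.
Proof. by rewrite subr_ge0 ler_pdivrMr ?ltr0n // -natrM ler_nat [(d2 * _)%N]mulnC. Qed.

(** The quadratic has a positive root because (b - c) + a c > 0: if d1 = 0, then
    c = 0 and d2 > 0, and otherwise a c > 0.  If a = l, the equation for l reduces to
    l (b - a) = 0, against d1 <> d2. *)
Lemma exists_quotient_radius :
  exists l : R, [/\ 0 < l, l ^+ 2 = (b - c) * l + a * c & a != l].
Proof.
have c_ge0 : 0 <= c by rewrite divr_ge0 ?ler0n.
have a_ge0 : 0 <= a by exact: ler0n.
have [||l l_gt0 l_root] := @pos_root_monic_quadratic R (b - c) (a * c) bc_ge0.
- exact: mulr_ge0.
- have [d10|d1_gt0] := posnP d1.
    rewrite /c /a d10 muln0 mul0r subr0 mulr0 addr0 ltr0n lt0n.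
    by apply/eqP => d20; apply: d12; rewrite d10 d20.
  apply: ltr_wpDl; first exact: bc_ge0.
  by rewrite mulr_gt0 ?divr_gt0 ?ltr0n ?muln_gt0 ?n1_gt0.
exists l; split=> //; apply/eqP => al.
have : l * (b - a) = 0 by move: l_root; rewrite -al; lra.
move/eqP; rewrite mulf_eq0 subr_eq0 (gt_eqF l_gt0) eqr_nat => /eqP.
by move/esym.
Qed.

Variable l : R.
Hypotheses (l_gt0 : 0 < l) (l_root : l ^+ 2 = (b - c) * l + a * c) (a_neq_l : a != l).

Let ac0 : a = 0 -> c = 0.
Proof. by move/eqP; rewrite pnatr_eq0 /c => /eqP ->; rewrite muln0 mul0r. Qed.

Lemma block_mass_balanced S : #|S| = n1 -> #|S|%:R * a = #|~: S|%:R * c.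
Proof.
by move=> S1; rewrite (card_setC_add S1) S1 [RHS]mulrC divfK // natrM.
Qed.

Lemma exists_notin_block S : #|S| = n1 -> exists i, i \notin S.
Proof.
move/card_setC_add => SC; have : (0 < #|~: S|)%N by rewrite SC.
by case/card_gt0P => i; rewrite inE; exists i.
Qed.

Lemma matrix_family_ge (M : 'M[R]_(n1 + n2)) :
  matrix_family d1 d2 M -> l <= spectral_radius M.
Proof.
case=> M_sym M_ge0 [S [S1 M_row]].
apply: (@spectral_radius_two_blocks_ge R _ S M a b c l) => //.
- by move=> i iS; rewrite M_row iS.
- by move=> i /negbTE iS; rewrite M_row iS.
- exact: block_mass_balanced.
- exact: exists_notin_block.
Qed.

(** The row sums leave one degree of freedom to a symmetric matrix that is
    constant on the blocks, namely its mass on the left block; it is 0 here. *)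
Definition optimal_matrix : 'M[R]_(n1 + n2) :=
  \matrix_(i, j) if i \in left_block
                 then if j \in left_block then 0 else a / n2%:R
                 else if j \in left_block then a / n2%:R else (b - c) / n2%:R.

Lemma sum_const_right (x : R) :
  \sum_(j | j \notin left_block) x / n2%:R = x.
Proof.
rewrite (eq_bigl (mem (~: left_block))) => [|j]; last by rewrite /= inE.
by rewrite sumr_const (card_setC_add card_left_block) -[RHS](divfK n2_neq0) mulr_natr.
Qed.

Lemma tr_optimal_matrix : optimal_matrix^T = optimal_matrix.
Proof. by apply/matrixP => i j; rewrite !mxE; do 2!case: ifP. Qed.

Lemma optimal_matrix_ge0 i j : 0 <= optimal_matrix i j.
Proof.
by rewrite mxE; do 2!case: ifP => _; rewrite // divr_ge0 ?ler0n ?bc_ge0.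
Qed.

Lemma optimal_matrix_left i j : i \in left_block -> j \in left_block ->
  optimal_matrix i j = 0.
Proof. by move=> iS jS; rewrite mxE iS jS. Qed.

Lemma optimal_matrix_left_right i : i \in left_block ->
  \sum_(j | j \notin left_block) optimal_matrix i j = a.
Proof.
move=> iS; rewrite -[RHS]sum_const_right; apply: eq_bigr => j /negbTE jS.
by rewrite mxE iS jS.
Qed.

Lemma optimal_matrix_right_left i : i \notin left_block ->
  \sum_(j in left_block) optimal_matrix i j = c.
Proof.
move=> iS; rewrite (eq_bigr (fun=> a / n2%:R)) => [|j jS]; last first.
  by rewrite mxE (negbTE iS) jS.
by rewrite sumr_const card_left_block /c natrM -mulrA mulr_natl.
Qed.

Lemma optimal_matrix_right i : i \notin left_block ->
  \sum_(j | j \notin left_block) optimal_matrix i j = b - c.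
Proof.
move=> iS; rewrite -[RHS]sum_const_right; apply: eq_bigr => j jS.
by rewrite mxE (negbTE iS) (negbTE jS).
Qed.

Lemma optimal_matrix_family : matrix_family d1 d2 optimal_matrix.
Proof.
split; [exact: tr_optimal_matrix | exact: optimal_matrix_ge0 |].
exists left_block; split=> [|i]; first exact: card_left_block.
rewrite (bigID (mem left_block)) /=; case: ifPn => iS.
  rewrite optimal_matrix_left_right // big1 ?add0r // => j jS.
  exact: optimal_matrix_left.
by rewrite optimal_matrix_right_left // optimal_matrix_right // addrC subrK.
Qed.

Lemma optimal_matrix_le : spectral_radius optimal_matrix <= l.
Proof.
have optC i j : optimal_matrix j i = optimal_matrix i j.
  by rewrite -[in LHS]tr_optimal_matrix mxE.
apply: (@spectral_radius_two_blocks_le R _ left_block _ a b c) => //.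
- exact: optimal_matrix_ge0.
- by move=> i j iS jS; apply: optimal_matrix_left.
- move=> i iS; rewrite (eq_bigr _ (fun j _ => optC i j)).
  exact: optimal_matrix_left_right.
- move=> i iS; rewrite (eq_bigr _ (fun j _ => optC i j)).
  exact: optimal_matrix_right_left.
- move=> i iS; rewrite (eq_bigr _ (fun j _ => optC i j)).
  exact: optimal_matrix_right.
Qed.

(** The equality case forces the n1 vertices of degree d1 to be independent and
    each other vertex to have c = n1 d1 / n2 neighbours among them; the
    four conditions then count vertices and edges. *)
Lemma extremal_graph_conditions e :
  graph_family d1 d2 e -> spectral_radius (adjacency R e) <= l ->
  [/\ ~~ odd (n2 * d2 + n1 * d1), n2 %| n1 * d1, d1 <= n2 &
      n2 * d2 - n1 * d1 <= n2 * (n2 - 1)]%N.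
Proof.
move=> e_fam rho_le; have [[e_sym e_irr] [S [S1 deg_e]]] := e_fam.
have SC := card_setC_add S1.
have deg_in i : i \in S -> (\sum_j e i j = d1)%N.
  by rewrite -degree_sum deg_e => ->.
have deg_out i : i \notin S -> (\sum_j e i j = d2)%N.
  by rewrite -degree_sum deg_e => /negbTE ->.
have [||e_in e_out] := @spectral_radius_two_blocks_eq R _ S
    (adjacency R e) a b c l l_gt0 l_root (adjacency_ge0 e)
    (tr_adjacency e_sym) _ _ (block_mass_balanced S1) (exists_notin_block S1)
    rho_le a_neq_l.
- by move=> i iS; rewrite sum_adjacency deg_in.
- by move=> i iS; rewrite sum_adjacency deg_out.
have [u uS] := exists_notin_block S1.
have uc : (n2 * (\sum_(j in S) e u j) = n1 * d1)%N.
  apply/eqP; rewrite -(eqr_nat R) natrM -sum_adjacency e_out // mulrC.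
  by rewrite divfK.
have le_SC (i : 'I_(n1 + n2)) : (\sum_(j | j \notin S) e i j <= n2)%N.
  rewrite -[leqRHS]SC -sum1_card (eq_bigl (mem (~: S))) => [|j]; last by rewrite /= inE.
  by apply: leq_sum => j _; case: (e i j).
split.
- suff <- : (\sum_i \sum_j e i j = n2 * d2 + n1 * d1)%N by exact: handshake_even.
  rewrite (bigID (mem S)) /= addnC; congr (_ + _)%N.
    rewrite -[X in _ = (X * _)%N]SC -sum_nat_const.
    apply: eq_big => [i|i iS]; first by rewrite inE.
    exact: deg_out.
  by rewrite -[X in _ = (X * _)%N]S1 -sum_nat_const; apply: eq_bigr => i; exact: deg_in.
- by rewrite -uc dvdn_mulr.
- have /card_gt0P[i iS] : (0 < #|S|)%N by rewrite S1.
  rewrite -(deg_in i iS) (bigID (mem S)) /= big1 ?add0n // => j jS.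
  by apply/eqP; rewrite -(pnatr_eq0 R) -(e_in i j iS jS) mxE.
have : (\sum_(j | j \notin S) e u j <= n2 - 1)%N.
  rewrite (bigD1 u) //= e_irr add0n -[X in (_ <= X - 1)%N]SC.
  rewrite (cardsD1 u) inE uS addKn -sum1_card.
  rewrite [leqLHS](eq_bigl (mem (~: S :\ u))) => [|j]; last by rewrite /= !inE andbC.
  by apply: leq_sum => j _; case: (e u j).
have := deg_out u uS; rewrite (bigID (mem S)) /= -uc => <-.
by rewrite mulnDr addKn leq_mul2l => ->; rewrite orbT.
Qed.

Lemma extremal_graph_exists :
  [/\ ~~ odd (n2 * d2 + n1 * d1), n2 %| n1 * d1, d1 <= n2 &
      n2 * d2 - n1 * d1 <= n2 * (n2 - 1)]%N ->
  exists2 e : rel 'I_(n1 + n2),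
    graph_family d1 d2 e & spectral_radius (adjacency R e) <= l.
Proof.
case=> even_mass n2_dvd d1_le k_le; set q := (n1 * d1 %/ n2)%N.
have n2q : (n2 * q = n1 * d1)%N by rewrite mulnC divnK.
have q_le : (q <= d2)%N by rewrite -(leq_pmul2l n2_gt0) n2q.
have n2k : (n2 * (d2 - q) = n2 * d2 - n1 * d1)%N by rewrite mulnBr n2q.
have cE : c = q%:R by rewrite /c -n2q natrM mulrC mulKf.
have [||e [e_simple e_ll e_lr e_rl e_rr]] :=
    @two_block_graph_exists n1 n2 d1 (d2 - q) d1_le n2_gt0 n2_dvd.
- by move: k_le; rewrite -n2k leq_pmul2l // subn1 -ltnS prednK.
- by rewrite n2k oddB // -oddD.
have e_sym := e_simple.1.
have leftP i : i \in left_block -> exists i', i = lshift n2 i'.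
  by case/imsetP => i' _ ->; exists i'.
have rightP i : i \notin left_block -> exists j, i = rshift n1 j.
  case: (split_ordP i) => [i' ->|j ->]; last by exists j.
  by rewrite lshift_left_block.
have adjC i j : adjacency R e j i = adjacency R e i j by rewrite !mxE e_sym.
exists e.
  split=> //; exists left_block; split=> [|i]; first exact: card_left_block.
  rewrite degree_sum (bigID (mem left_block)) /= sum_left_block sum_right_block.
  case: ifPn => [/leftP[i' ->]|/rightP[j ->]].
    by rewrite e_lr big1 // => i'' _; rewrite e_ll.
  by rewrite e_rl e_rr subnKC.
apply: (@spectral_radius_two_blocks_le R _ left_block _ a b c) => //.
- exact: adjacency_ge0.
- by move=> i j /leftP[i' ->] /leftP[j' ->]; rewrite mxE e_ll.
- move=> i /leftP[i' ->]; rewrite (eq_bigr _ (fun j _ => adjC _ j)).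
  by rewrite sum_adjacency sum_right_block e_lr.
- move=> i /rightP[i' ->]; rewrite (eq_bigr _ (fun j _ => adjC _ j)).
  by rewrite sum_adjacency sum_left_block e_rl.
- move=> i /rightP[i' ->]; rewrite (eq_bigr _ (fun j _ => adjC _ j)).
  by rewrite sum_adjacency sum_right_block e_rr cE natrB.
Qed.

End Families.

Theorem theorem1p6 (R : realType) (n1 n2 d1 d2 : nat) :
  0 < n1 -> 0 < n2 -> d1 <> d2 -> n1 * d1 <= n2 * d2 ->
  (exists r : R, is_rho_graph d1 n1 d2 n2 r /\ is_rho_matrix d1 n1 d2 n2 r) <->
  [/\ ~~ odd (n2 * d2 + n1 * d1), n2 %| n1 * d1, d1 <= n2 &
      n2 * d2 - n1 * d1 <= n2 * (n2 - 1)].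
Proof.
move=> n1_gt0 n2_gt0 d12 le_mass.
have [l [l_gt0 l_root a_neq_l]] :=
  @exists_quotient_radius R _ _ _ _ n1_gt0 n2_gt0 d12 le_mass.
have rho_ge := matrix_family_ge n2_gt0 l_gt0 l_root.
split=> [[r [[[e e_fam <-] _] [_ r_min]]] | conds].
  apply: (@extremal_graph_conditions R _ _ _ _ n1_gt0 n2_gt0 _
            l_gt0 l_root a_neq_l e e_fam).
  apply: le_trans (optimal_matrix_le n2_gt0 le_mass l_gt0 l_root).
  apply: r_min; exists (optimal_matrix R n1 n2 d1 d2) => //.
  exact: optimal_matrix_family.
have [e e_fam rho_e] := extremal_graph_exists n2_gt0 le_mass l_gt0 l_root conds.
have e_mat := adjacency_matrix_family R e_fam.
have rhoE : spectral_radius (adjacency R e) = l.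
  by apply/eqP; rewrite eq_le rho_e rho_ge.
exists l; split; split.
- by exists e.
- by move=> _ [f /(adjacency_matrix_family R) f_mat <-]; exact: rho_ge.
- by exists (adjacency R e).
- by move=> _ [M M_fam <-]; exact: rho_ge.
Qed.
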